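(* Let $(\Omega,\mathcal{F},\mu)$ be a $\sigma$-finite measured space and let $X$ be a nonempty subset of $L^1_{\oplus}(\Omega,\mathcal{F},\mu;\overline{\mathbb{R}})$. Then $\operatorname{ess\,inf}_{x\in X}x\in L^1_{\oplus}(\Omega,\mathcal{F},\mu;\overline{\mathbb{R}})$, and the equality $$\inf_{x\in X}\int_\Omega x\,d\mu=\int_\Omega \operatorname{ess\,inf}_{x\in X}x\,d\mu$$ holds if and only if $X$ is integrably inf-directed, i.e. for every finite family $x_1,\dots,x_n$ ($n\ge 1$) in $X$, $$\inf_{x\in X}\int_\Omega x\,d\mu\le\int_\Omega\inf_{1\le i\le n}x_i\,d\mu.$$
   Context: $\overline{\mathbb{R}}=\mathbb{R}\cup\{\pm\infty\}$. $L^0(\Omega,\mathcal{F},\mu;\overline{\mathbb{R}})$ is the set of $\mu$-a.e. equivalence classes of measurable functions $\Omega\to\overline{\mathbb{R}}$, ordered by the $\mu$-pointwise order ($f\le g$ iff $f(\omega)\le g(\omega)$ for $\mu$-almost every $\omega$). For $f\in L^0$, $f_+=\sup(0,f)$ and $f_-=\sup(0,-f)$. $L^1_{\oplus}(\Omega,\mathcal{F},\mu;\overline{\mathbb{R}})=\{f\in L^0(\Omega,\mathcal{F},\mu;\overline{\mathbb{R}}):\int_\Omega f_+\,d\mu<+\infty\}$. On it, $\int$ is the extended Lebesgue integral $\int_\Omega f\,d\mu=\int_\Omega f_+\,d\mu-\int_\Omega f_-\,d\mu\in[-\infty,+\infty)$. The essential infimum $\operatorname{ess\,inf}_{x\in X}x$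 is the greatest lower bound of $X$ in $L^0(\Omega,\mathcal{F},\mu;\overline{\mathbb{R}})$ for the $\mu$-pointwise order. *)

(* Defs.v *)
From HB Require Import structures.
From mathcomp Require Import all_boot all_order all_algebra.
From mathcomp Require Import all_classical all_reals all_analysis.
From mathcomp Require Import measurable_realfun.

Set Implicit Arguments.
Unset Strict Implicit.
Unset Printing Implicit Defensive.

Import Order.TTheory GRing.Theory Num.Theory.

Local Open Scope classical_set_scope.
Local Open Scope ring_scope.
Local Open Scope ereal_scope.
Local Open Scope quotient_scope.

(* An element of [L0 mu] is an equivalence class modulo equality [mu]-a.e.; it
   coerces to the function [T -> \bar R] given by a chosen representative. *)
Definition L0 d (T : measurableType d) (R : realType)
    (mu : {measure set T -> \bar R}) : Type := {mfun_ mu, T >-> \bar R}.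

Definition L0_to_fun d (T : measurableType d) (R : realType)
  (mu : {measure set T -> \bar R}) (f : L0 mu) : T -> \bar R :=
  aqEqMfun_to_fun f.
Coercion L0_to_fun : L0 >-> Funclass.

Fact L0_display : Order.disp_t. Proof. exact: (Order.Disp tt tt). Qed.

Section L0_porder.
Context d (T : measurableType d) (R : realType).
Variable mu : {measure set T -> \bar R}.
Implicit Types f g h : L0 mu.

HB.instance Definition _ := Choice.on (L0 mu).
HB.instance Definition _ := EqQuotient.on (L0 mu).

Definition L0_le f g : bool := `[< {ae mu, forall t, f t <= g t} >].

Fact L0_le_refl : reflexive L0_le.
Proof. by move=> f; apply/asboolP; apply: aeW => t. Qed.

Fact L0_le_anti : antisymmetric L0_le.
Proof.
move=> f g /andP[/asboolP fg /asboolP gf].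
rewrite -[f]reprK -[g]reprK; apply/eqmodP/asboolP.
by apply: filterS2 fg gf => t fgt gft _; apply/eqP; rewrite eq_le fgt.
Qed.

Fact L0_le_trans : transitive L0_le.
Proof.
move=> g f h /asboolP fg /asboolP gh; apply/asboolP.
by apply: filterS2 fg gh => t; exact: le_trans.
Qed.

HB.instance Definition _ := Order.Le_isPOrder.Build L0_display (L0 mu)
  L0_le_refl L0_le_anti L0_le_trans.

End L0_porder.

Section essinf.
Context d (T : measurableType d) (R : realType).
Variable mu : {measure set T -> \bar R}.

Definition L1plus : set (L0 mu) := 
  [set f : L0 mu | \int[mu]_t (f^\+ t) < +oo].

(* The default value, which is that of [essinf set0], is the class of the
   constant [+oo], that is, the greatest element of [L0 mu]. *)
Definition essinf (X : set (L0 mu)) : L0 mu :=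
  infimum (\pi_(L0 mu) (cst +oo : {mfun T >-> \bar R})) X.

(* The pointwise minimum of representatives is a representative of the infimum
   of the classes. *)
Definition integrably_inf_directed (X : set (L0 mu)) : Prop :=
  forall (n : nat) (x : 'I_n -> L0 mu), (0 < n)%N -> (forall i, X (x i)) ->
    ereal_inf [set \int[mu]_t y t | y in X] <=
    \int[mu]_t \big[mine/+oo]_(i < n) x i t.

End essinf.
Arguments L1plus {d T R} mu.

(* Main.v *)
(* On a sigma-finite space, essinf X is the pointwise infimum of a sequence
   (x_n) in X: for each rational q, the essential union of the sets {f < q},
   f in X, is a countable union, obtained by maximizing measures within sets of
   finite measure.  The minima y_n of x_0, ..., x_n then decrease to essinf X,
   so their integrals converge to that of essinf X; when X is integrably
   inf-directed these integrals are all at least the infimum of the integrals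
   over X. *)
Require Import Defs.
From HB Require Import structures.
From mathcomp Require Import all_boot all_order all_algebra.
From mathcomp Require Import all_classical all_reals all_analysis.
From mathcomp Require Import measurable_realfun.

Set Implicit Arguments.
Unset Strict Implicit.
Unset Printing Implicit Defensive.

Local Open Scope classical_set_scope.
Local Open Scope ring_scope.
Local Open Scope ereal_scope.

Import Order.TTheory GRing.Theory Num.Theory.
Import numFieldNormedType.Exports.

(** Pairs [(k, n)] are enumerated through [pickle], with [i0] at the codes that decode to nothing.
    This turns countably many sequences into one that exhausts them all. *)
Lemma merge_sequences (K : countType) (I : Type) (i0 : I) (s : K -> nat -> I) :
  exists t : nat -> I, forall k n, exists m, t m = s k n.
Proof.
exists (fun m => if unpickle m is Some p then s p.1 p.2 else i0) => k n.
by exists (pickle (k, n)); rewrite pickleK.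
Qed.

Lemma lte_rat_between (R : realType) (x y : \bar R) : x < y ->
  exists q : rat, x < (ratr q)%:E /\ (ratr q)%:E < y.
Proof.
have between (a b : R) : (a < b)%R ->
    exists q : rat, a%:E < (ratr q)%:E /\ (ratr q)%:E < b%:E.
  move=> /rat_in_itvoo[q]; rewrite in_itv/= => /andP[aq qb].
  by exists q; rewrite !lte_fin.
case: x y => [a| |] [b| |] //=; first by rewrite lte_fin; exact: between.
- have [|q [aq _]] := between a (a + 1)%R; first by rewrite ltrDl.
  by exists q; rewrite ltry.
- have [|q [_ qb]] := between (b - 1)%R b; first by rewrite gtrBl.
  by exists q; rewrite ltNyr.
- by exists 0%R; rewrite ltry ltNyr.
Qed.

(** * Countable essential unions of arbitrary families of measurable sets *)

Section ess_union.
Context d (T : measurableType d) (R : realType) (I : Type).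
Variables (mu : {measure set T -> \bar R}) (A : I -> set T) (i0 : I).
Hypothesis mA : forall i, measurable (A i).

(** For a sequence maximizing the measure of its union within [F], adjoining one more [A i] cannot
    increase that measure. The maximum is finite because [mu F] is, so it cancels and the added part
    is null. *)
Lemma countable_ess_union_fin (F : set T) : measurable F -> mu F < +oo ->
  exists s : nat -> I,
    forall i, mu (F `&` (A i `\` \bigcup_n A (s n))) = 0.
Proof.
move=> mF Foo.
have mU (s : nat -> I) : measurable (\bigcup_n A (s n)).
  by apply: bigcup_measurable.
have mFU (s : nat -> I) : measurable (F `&` \bigcup_n A (s n)).
  exact: measurableI.
pose V (s : nat -> I) := mu (F `&` \bigcup_n A (s n)).
pose M := ereal_sup (range V).
have VM s : V s <= M by apply: ereal_sup_ubound; exists s.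
have Mfin : M \is a fin_num.
  rewrite ge0_fin_numE; last exact: le_trans (measure_ge0 _ _) (VM (fun=> i0)).
  apply: le_lt_trans Foo; apply: ge_ereal_sup => _ [s _ <-].
  by apply: le_measure; rewrite ?inE//; exact: subIsetl.
have /choice[s sM] k : exists s, M - k.+1%:R^-1%:E < V s.
  have k0 : (0 < k.+1%:R^-1 :> R)%R by rewrite invr_gt0.
  have [_ [s _ <-] Ms] := ub_ereal_sup_adherent k0 Mfin.
  by exists s.
have [t tE] := merge_sequences i0 s.
(* The supremum is attained: the union along [t] contains the union along each [s k], whose measure
   within [F] exceeds [M - 1/(k+1)]. *)
have VtM : V t = M.
  apply/eqP; rewrite eq_le VM/=; apply/lee_subgt0Pr => e e0.
  have [k ke] : exists k, (k.+1%:R^-1 < e)%R.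
    have [k _ ke] := near_infty_natSinv_lt (PosNum e0).
    by exists k; exact: (ke k (leqnn _)).
  apply: (@le_trans _ _ (V (s k))).
    apply/ltW/(le_lt_trans _ (sM k)).
    by rewrite leeB// lee_fin ltW.
  apply: le_measure; rewrite ?inE//; apply: setIS => x [n _ Ax].
  by have [m tm] := tE k n; exists m => //; rewrite tm.
exists t => i.
(* Prepending [i] to [t] splits the new union into the old one and what [A i] adds. *)
pose t' n := if n is n'.+1 then t n' else i.
have mAt : measurable (F `&` (A i `\` \bigcup_n A (t n))).
  by apply: measurableI => //; exact: measurableD.
have : V t' = V t + mu (F `&` (A i `\` \bigcup_n A (t n))).
  rewrite /V -measureU//; last first.
    by rewrite -subset0 => x [[_ xU] [_ [_]]].
  congr (mu _); rewrite -setIUr; congr (_ `&` _); apply/seteqP; split => x.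
    move=> [[|n] _ /=] Ax; last by left; exists n.
    by case: (pselect ((\bigcup_n A (t n)) x)) => [|nU]; [left|right].
  by move=> [[n _ Ax]|[Ax _]]; [exists n.+1|exists 0%N].
rewrite VtM => Vt'; apply/eqP; rewrite eq_le measure_ge0 andbT.
by rewrite -(leeD2lE _ _ Mfin) -Vt' adde0 VM.
Qed.

(** After merging the sequences found for the pieces [F k] of a sigma-finite cover, what remains of
    [A i] lies in a countable union of null sets, one for each piece. *)
Lemma countable_ess_union : sigma_finite setT mu ->
  exists s : nat -> I, forall i, mu (A i `\` \bigcup_n A (s n)) = 0.
Proof.
move=> [F TF mF].
have /choice[s s0] k := countable_ess_union_fin (mF k).1 (mF k).2.
have [t tE] := merge_sequences i0 s.
have mAt i : measurable (A i `\` \bigcup_n A (t n)).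
  by apply: measurableD => //; apply: bigcup_measurable.
exists t => i; apply: measure_negligible => //.
apply: (@negligibleS _ _ _ _
    (\bigcup_k (F k `&` (A i `\` \bigcup_n A (s k n))))).
  move=> x [Ax tx]; have : setT x by [].
  rewrite TF => -[k _ Fkx]; exists k => //; split=> //; split=> // -[n _ Anx].
  by apply: tx; have [m tm] := tE k n; exists m => //; rewrite tm.
apply: negligible_bigcup => k; apply/negligibleP; last exact: s0.
apply: measurableI; [exact: (mF k).1|].
by apply: measurableD => //; apply: bigcup_measurable.
Qed.

End ess_union.

(** * Essential lower bounds given by countable pointwise infima *)

Section ess_inf.
Context d (T : measurableType d) (R : realType).
Variable mu : {measure set T -> \bar R}.

Lemma measurable_ereal_inf (f : nat -> T -> \bar R) :
  (forall n, measurable_fun setT (f n)) ->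
  measurable_fun setT (fun t => ereal_inf (range (f ^~ t))).
Proof.
move=> mf; have := measurable_fun_einfs mf 0.
apply: eq_measurable_fun => t _; rewrite /einfs/= /sdrop; congr (ereal_inf _).
by apply/seteqP; split => _ [n _ <-]; exists n.
Qed.

(** If [f t] is below the infimum of the sequence at [t], a rational [q] lies strictly between, and
    [t] is in the sublevel set [A q f] but in none of those chosen for [q]. For each [q] such points
    form a null set. *)
Lemma countable_ess_inf (X : set (T -> \bar R)) :
  sigma_finite setT mu -> X !=set0 ->
  (forall f, X f -> measurable_fun setT f) ->
  exists2 s : nat -> T -> \bar R, forall n, X (s n) &
    forall f, X f -> {ae mu, forall t, ereal_inf (range (s ^~ t)) <= f t}.
Proof.
move=> muT [f0 Xf0] mX.
pose A q (f : {f | X f}) := [set t | proj1_sig f t < (ratr q)%:E].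
have mA q f : measurable (A q f).
  rewrite -[A q f]setTI; apply: emeasurable_fun_infty_o => //.
  exact: mX (proj2_sig f).
pose i0 : {f | X f} := exist _ f0 Xf0.
have /choice[s s0] q := countable_ess_union i0 (mA q) muT.
have [t tE] := merge_sequences i0 s.
exists (fun n => proj1_sig (t n)) => [n|f Xf]; first exact: proj2_sig.
pose i : {f | X f} := exist _ f Xf.
(* The union over the rationals is indexed by their codes, with [set0] at codes of no rational. *)
have : mu.-negligible (\bigcup_k if unpickle k is Some q then
    A q i `\` \bigcup_n A q (s q n) else set0).
  apply: negligible_bigcup => k; case: unpickle => [q|];
    last exact: negligible_set0.
  apply/negligibleP; last exact: s0.
  by apply: measurableD => //; apply: bigcup_measurable.
apply: negligibleS => x /= /negP; rewrite -ltNge => /lte_rat_between[q [fq qs]].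
exists (pickle q); [exact: I|rewrite pickleK; split; [exact: fq|]].
move=> -[n _ snq].
have [m tm] := tE q n.
suff : (ratr q)%:E < (ratr q)%:E :> \bar R by rewrite ltxx.
apply/(lt_trans qs)/(le_lt_trans _ snq)/ereal_inf_lbound.
by exists m => //=; rewrite tm.
Qed.

End ess_inf.

(** * Monotonicity and decreasing limits for the extended integral *)

Section integral.
Context d (T : measurableType d) (R : realType).
Variable mu : {measure set T -> \bar R}.

Lemma ae_le_integral (f g : T -> \bar R) :
  measurable_fun setT f -> measurable_fun setT g ->
  {ae mu, forall t, f t <= g t} -> \int[mu]_t f t <= \int[mu]_t g t.
Proof.
move=> mf mg fg; rewrite integralE [leRHS]integralE.
(* Since [+oo - +oo] is [-oo], subtraction is monotone on all of [\bar R], and the two parts can be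
   compared separately. *)
apply: leeB; apply: ae_ge0_le_integral => //.
- exact: measurable_funepos.
- exact: measurable_funepos.
- apply: filterS fg => t fgt _.
  by rewrite !funeposE ge_max !le_max fgt lexx orbT.
- exact: measurable_funeneg.
- exact: measurable_funeneg.
- apply: filterS fg => t fgt _.
  by rewrite !funenegE ge_max !le_max leeN2 fgt lexx orbT.
Qed.

(** Identifies the limit of the positive parts of a decreasing sequence. *)
Lemma funepos_ereal_inf (u : nat -> \bar R) :
  maxe (ereal_inf (range u)) 0 = ereal_inf (range (fun n => maxe (u n) 0)).
Proof.
apply/eqP; rewrite eq_le; apply/andP; split.
  apply: le_ereal_inf_tmp => _ [n _ <-].
  rewrite ge_max !le_max lexx orbT andbT; apply/orP; left.
  by apply: ereal_inf_lbound; exists n.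
rewrite leNgt; apply/negP; rewrite gt_max.
move=> /andP[/ereal_inf_ltP[_ [n _ <-]] un pos].
have : ereal_inf (range (fun n => maxe (u n) 0)) <= maxe (u n) 0.
  by apply: ereal_inf_lbound; exists n.
by rewrite leNgt gt_max un pos.
Qed.

Lemma funeneg_ereal_inf (u : nat -> \bar R) :
  maxe (- ereal_inf (range u)) 0 = ereal_sup (range (fun n => maxe (- u n) 0)).
Proof.
apply/eqP; rewrite eq_le; apply/andP; split; last first.
  apply: ge_ereal_sup => _ [n _ <-].
  rewrite ge_max !le_max lexx orbT andbT leeN2; apply/orP; left.
  by apply: ereal_inf_lbound; exists n.
rewrite ge_max; apply/andP; split; last first.
  (* The term of index 0 makes the supremum nonnegative; over an empty range it would be [-oo]. *)
  apply: le_trans (ereal_sup_ubound _); last by exists 0%N.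
  by rewrite le_max lexx orbT.
rewrite leeNl; apply: le_ereal_inf_tmp => _ [n _ <-]; rewrite leeNl.
apply: le_trans (ereal_sup_ubound _); last by exists n.
by rewrite le_max lexx.
Qed.

(* Dominated convergence handles the positive parts and monotone convergence
   the negative ones, whose integrals may be infinite. *)
Lemma cvg_integral_nonincreasing (y : nat -> T -> \bar R) :
  (forall n, measurable_fun setT (y n)) ->
  (forall t, {homo y ^~ t : m n / (m <= n)%N >-> n <= m}) ->
  \int[mu]_t (y 0%N)^\+ t < +oo ->
  \int[mu]_t y n t @[n --> \oo] -->
    \int[mu]_t ereal_inf (range (y ^~ t)).
Proof.
move=> my ymono y0oo.
have mg : measurable_fun setT (fun t => ereal_inf (range (y ^~ t))).
  exact: measurable_ereal_inf.
have y0int : mu.-integrable setT (y 0%N)^\+.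
  apply/integrableP; split; first exact: measurable_funepos.
  by under eq_integral do rewrite gee0_abs//.
have posle t m n : (m <= n)%N -> (y n)^\+ t <= (y m)^\+ t.
  by move=> mn; rewrite !funeposE ge_max !le_max ymono// lexx orbT.
have negle t m n : (m <= n)%N -> (y m)^\- t <= (y n)^\- t.
  by move=> mn; rewrite !funenegE ge_max !le_max leeN2 ymono// lexx orbT.
have [||||gint _ poscvg] := @dominated_convergence _ _ _ mu setT measurableT
    (fun n => (y n)^\+) (fun t => ereal_inf (range (y ^~ t)))^\+ (y 0%N)^\+
    _ _ _ y0int _.
- by move=> n; exact: measurable_funepos.
- exact: measurable_funepos.
- apply: aeW => t _; rewrite funeposE funepos_ereal_inf.
  under [in X in _ --> X]eq_fun do rewrite -(funeposE (y _) t).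
  by apply: ereal_nonincreasing_cvgn => m n; exact: posle.
- by apply: aeW => t n _; rewrite gee0_abs// posle.
have negcvg : \int[mu]_t (y n)^\- t @[n --> \oo] -->
    \int[mu]_t (fun t => ereal_inf (range (y ^~ t)))^\- t.
  under [X in _ --> X]eq_integral => t _.
    have -> : (fun t => ereal_inf (range (y ^~ t)))^\- t =
        limn (fun n => (y n)^\- t).
      rewrite funenegE funeneg_ereal_inf.
      under [in LHS]eq_fun do rewrite -(funenegE (y _) t).
      apply/esym/cvg_lim => //.
      by apply: ereal_nondecreasing_cvgn => m n; exact: negle.
    over.
  apply: cvg_monotone_convergence => // [n|t _ m n]; last exact: negle.
  exact: measurable_funeneg.
rewrite [X in _ --> X]integralE.
under eq_cvg do rewrite integralE.
(* The positive part of the limit has a finite integral, so the limiting difference is not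
   [+oo - +oo]. *)
apply: cvgeB => //; apply: fin_num_adde_defr.
exact: integrable_fin_num gint.
Qed.

End integral.

(** Allows a countable infimum to be written as the limit of the decreasing running minima; the
    bound [n.+1] puts [u n] itself in the [n]-th minimum. *)
Lemma ereal_inf_bigmin (R : realType) (u : nat -> \bar R) :
  ereal_inf (range (fun n => \big[mine/+oo]_(i < n.+1) u i)) =
  ereal_inf (range u).
Proof.
apply/eqP; rewrite eq_le; apply/andP; split.
  apply: le_ereal_inf_tmp => _ [n _ <-].
  apply: le_trans (ereal_inf_lbound _) _; first by exists n.
  exact: (bigmin_le _ (@ord_max n) (fun i => u i)).
apply: le_ereal_inf_tmp => _ [n _ <-].
apply: le_bigmin => [|i _]; first exact: leey.
by apply: ereal_inf_lbound; exists i.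
Qed.

Lemma measurable_bigmin d (T : measurableType d) (R : realType) n
    (f : 'I_n -> T -> \bar R) :
  (forall i, measurable_fun setT (f i)) ->
  measurable_fun setT (fun t => \big[mine/+oo]_(i < n) f i t).
Proof.
elim: n f => [|n IH] f mf.
  by under eq_fun do rewrite big_ord0; exact: measurable_cst.
under eq_fun do rewrite big_ord_recl.
by apply: measurable_mine => //; exact: IH.
Qed.

(** * Passage from functions to classes *)

Section L0.
Context d (T : measurableType d) (R : realType).
Variable mu : {measure set T -> \bar R}.
Implicit Types (f g : L0 mu) (X : set (L0 mu)).

Lemma L0_leP f g :
  reflect {ae mu, forall t, f t <= g t} (f <= g)%O.
Proof. exact: asboolP. Qed.

Lemma measurable_L0 f : measurable_fun setT f.
Proof. exact: measurable_funPT. Qed.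

(** The class of [g] is the witness; it coerces to the representative picked by [repr], hence
    equality only almost everywhere. *)
Lemma L0_surj (g : T -> \bar R) : measurable_fun setT g ->
  exists f : L0 mu, {ae mu, forall t, f t = g t}.
Proof.
move=> mg.
have gP : g \in mfun by rewrite inE.
exists (\pi_(L0 mu) (mfun_Sub gP))%qT.
have /eqmodP/asboolP : (\pi_(L0 mu) (repr (\pi_(L0 mu) (mfun_Sub gP))) =
    \pi_(L0 mu) (mfun_Sub gP))%qT by rewrite reprK.
by apply: filterS => t; exact.
Qed.

(** The class [G] of the pointwise infimum of the sequence is below each member of [X] by the choice
    of the sequence, and above each lower bound because only countably many null sets are discarded.
    Uniqueness of infima identifies it with [essinf X]. *)
Lemma essinf_countable X : sigma_finite setT mu -> X !=set0 ->
  exists x : nat -> L0 mu, [/\ forall n, X (x n), infimums X (essinf X) &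
    {ae mu, forall t, essinf X t = ereal_inf (range (fun n => x n t))}].
Proof.
move=> muT X0.
have [|_ [f Xf <-]|s Xs sinf] :=
  @countable_ess_inf _ _ _ mu [set (f : T -> \bar R) | f in X] muT.
- by have [f Xf] := X0; exists f; exists f.
- exact: measurable_L0.
have /choice[x xs] n : exists f, X f /\ (f : T -> \bar R) = s n.
  by have [f Xf fs] := Xs n; exists f.
have [G Gg] : exists G : L0 mu,
    {ae mu, forall t, G t = ereal_inf (range (fun n => x n t))}.
  by apply/L0_surj/measurable_ereal_inf => n; exact: measurable_L0.
have Ginf : infimums X G.
  split=> f Xf; apply/L0_leP.
    have := sinf _ (ex_intro2 _ _ f Xf erefl).
    apply: filterS2 Gg => t ->; congr (ereal_inf _ <= _).
    by apply: eq_imagel => n _; rewrite (xs n).2.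
  have : {ae mu, forall t, forall n, (f : L0 mu) t <= x n t}.
    by apply: ae_foralln => n; apply/L0_leP/Xf; exact: (xs n).1.
  apply: filterS2 Gg => t -> fx.
  by apply: le_ereal_inf_tmp => _ [n _ <-].
have Einf : infimums X (essinf X).
  (* [infimum] is a choice with a default value, which the existence of [G] rules out. *)
  rewrite /essinf /infimum; case: eqP X0 => [-> /set0P/eqP//|_ _].
  by apply: xgetPex; exists G.
exists x; split => //; first by move=> n; exact: (xs n).1.
by rewrite (is_subset1_infimums Einf Ginf).
Qed.

End L0.

Theorem theorem7 (d : measure_display) (T : measurableType d) (R : realType)
    (mu : {sigma_finite_measure set T -> \bar R}) (X : set (L0 mu))
    (X_nonempty : X !=set0) (X_L1plus : X `<=` L1plus mu) :
  [/\ infimums X (essinf X),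
      L1plus mu (essinf X) &
      (ereal_inf [set \int[mu]_t x t | x in X] = \int[mu]_t essinf X t <->
       integrably_inf_directed X)].
Proof.
have [x [Xx Einf Ex]] := essinf_countable (sigma_finiteT mu) X_nonempty.
have E_le f : X f -> {ae mu, forall t, essinf X t <= f t}.
  by move=> Xf; apply/L0_leP/Einf.1.
split => //.
  have [f Xf] := X_nonempty.
  apply: le_lt_trans (X_L1plus f Xf); apply: ae_le_integral.
  - exact/measurable_funepos/measurable_L0.
  - exact/measurable_funepos/measurable_L0.
  apply: filterS (E_le f Xf) => t ft.
  by rewrite !funeposE ge_max !le_max ft lexx orbT.
split=> [infE n y n0 Xy|Xdir].
  (* By the assumed equality the left side is the integral of [essinf X], which is almost everywhere
     below each finite minimum. *)
  rewrite infE; apply: ae_le_integral; first exact: measurable_L0.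
    by apply: measurable_bigmin => i; exact: measurable_L0.
  (* The successor form gives access to [inord], through which bounds indexed by [nat] cover the
     finite family. *)
  case: n y n0 Xy => // n y _ Xy.
  have : {ae mu, forall t, forall k, essinf X t <= y (inord k) t}.
    by apply: ae_foralln => k; exact: E_le.
  apply: filterS => t Ey; apply: le_bigmin => [|i _]; first exact: leey.
  by have := Ey i; rewrite inord_val.
apply/eqP; rewrite eq_le; apply/andP; split; last first.
  (* This inequality is monotonicity of the integral; directedness serves for the other one. *)
  apply: le_ereal_inf_tmp => _ [f Xf <-].
  by apply: ae_le_integral (E_le f Xf); exact: measurable_L0.
pose y n t := \big[mine/+oo]_(i < n.+1) x i t.
have my n : measurable_fun setT (y n).
  by apply: measurable_bigmin => i; exact: measurable_L0.
have -> : \int[mu]_t essinf X t = \int[mu]_t ereal_inf (range (y ^~ t)).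
  apply: ae_eq_integral => //; first exact: measurable_ereal_inf.
  by apply: filterS Ex => t -> _; rewrite -(ereal_inf_bigmin (fun n => x n t)).
apply: (@cvge_ge _ \oo _ _ (fun n => \int[mu]_t y n t)).
  by apply: nearW => n; apply: Xdir.
apply: cvg_integral_nonincreasing => //.
  move=> t m n mn.
  by apply: (le_bigmin_ord predT (fun i => x i t)); rewrite ltnS.
(* The first running minimum has a single term, so the finiteness of its positive part comes from
   [x 0%N] being in [X]. *)
have -> : y 0%N = x 0%N by apply/funext => t; rewrite /y big_ord1.
exact: X_L1plus.
Qed.
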